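(* Let $G=(V,E)$ be a connected graph with degree bounded by $d$ whose growth is bounded by a monotone function $f:\mathbb{N}\to\mathbb{N}$ of subexponential growth, and let $\epsilon>0$. Then there is a local sparse spanning graph algorithm for $G$ with query complexity and running time $O(d\cdot n_{r_f(\beta)}(G)) = O(d\cdot\exp(\beta\cdot r_f(\beta)))$, where $\beta=\frac{\epsilon}{2d}$.
   Context: Graphs have $n=|V|$ vertices, degree bound $d$, and distinct vertex ids; access is via incidence-list queries (the $i$-th neighbor of $v$). A local sparse spanning graph algorithm, given $n,\epsilon\ge0,0\le\delta<1$ and query access to a connected graph $G=(V,E)$, answers for each queried edge $(u,v)\in E$ whether $(u,v)\in E'$, where $E'$ is determined by $G$ and the algorithm's internal randomness, such that $G'=(V,E')$ is connected with probability $1$ and $|E'|\le(1+\epsilon)n$ with probability at least $1-\delta$. $\Gamma_k(v)$ is the set of vertices at distance at most $k$ from $v$, and $n_k(G)=\max_{v}|\Gamma_k(v)|$. A monotone $f:\mathbb{N}\to\mathbb{N}$ has subexponential growth if for every $\beta>0$ there is $r_f(\beta)>0$ with $f(r)\le\exp(\beta r)$ for all $r\ge r_f(\beta)$. $G$ has growth bounded by $f$ if $n_k(G)\le f(k)$ for every $k\ge1$. *)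

(* Defs.v *)
From HB Require Import structures.
From mathcomp Require Import all_boot all_order all_algebra.
From mathcomp Require Import reals sequences exp.

Set Implicit Arguments.
Unset Strict Implicit.
Unset Printing Implicit Defensive.

Import Order.TTheory GRing.Theory Num.Theory.

(* A finite simple graph presented by incidence lists: [nbrs v] lists the
   neighbours of [v] in the order in which queries return them. *)
Record graph := Graph {
  vertex :> finType;
  ident : vertex -> nat;
  nbrs : vertex -> seq vertex;
  ident_inj : injective ident;
  nbrs_uniq : forall v, uniq (nbrs v);
  nbrs_irrefl : forall v, v \notin nbrs v;
  nbrs_sym : forall u v, (v \in nbrs u) = (u \in nbrs v)
}.

Section Graphs.
Variable G : graph.

Definition adj : rel G := fun u v => v \in nbrs u.

Definition edges : {set {set G}} :=
  [set [set uv.1; uv.2] | uv : G * G & adj uv.1 uv.2].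

(* Connectedness of the spanning subgraph with vertex set [G] and edge set [F];
   it is only used with [F \subset edges]. *)
Definition edge_rel (F : {set {set G}}) : rel G := fun u v => [set u; v] \in F.

Definition connected (F : {set {set G}}) : bool :=
  (0 < #|G|) && [forall u, forall v, connect (edge_rel F) u v].

Definition degree_bounded (d : nat) : Prop := forall v : G, size (nbrs v) <= d.

(* Gamma_k(v): the endpoints of the walks of length at most [k] from [v]. *)
Definition ball (k : nat) (v : G) : {set G} :=
  [set w | [exists i : 'I_k.+1, exists p : i.-tuple G,
              path adj v p && (last v p == w)]].

Definition max_ball (k : nat) : nat := \max_(v : G) #|ball k v|.

Definition growth_bounded (f : nat -> nat) : Prop :=
  forall k, 1 <= k -> max_ball k <= f k.

(* Answer to "what is the [i]-th neighbour of the vertex with id [a]?"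
   ([i] counts from 0): [0] if there is none, and the id plus one otherwise. *)
Definition neighbor_oracle (a i : nat) : nat :=
  if [pick v : G | ident v == a] is Some v then
    if onth (nbrs v) i is Some w then (ident w).+1 else 0
  else 0.

End Graphs.

Definition subexponential_growth (R : realType) (f : nat -> nat)
    (rf : R -> nat) : Prop :=
  forall beta : R, (0 < beta)%R ->
    0 < rf beta /\
    forall r : nat, rf beta <= r -> ((f r)%:R <= expR (beta * r%:R))%R.

(* Unit-cost random access machine with structured control.  Registers and
   memory cells hold natural numbers and are initially [0] (apart from the
   inputs).  Every instruction and every test costs one time unit; the only
   arithmetic is addition and truncated subtraction. *)
Inductive instr :=
  | Const (x k : nat)
  | Move (x y : nat)
  | Add (x y z : nat)
  | Sub (x y z : nat)
  | Read (x y : nat)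
  | Write (x y : nat)
  | Rand (x y : nat)
  | Query (x y z : nat).

Inductive program :=
  | Skip
  | Do (i : instr)
  | Seq (c1 c2 : program)
  | If (x : nat) (c1 c2 : program)
  | While (x : nat) (c : program).

Record state := State { reg : nat -> nat; mem : nat -> nat }.

Definition upd (h : nat -> nat) (x a : nat) : nat -> nat :=
  fun y => if y == x then a else h y.

Definition is_query (i : instr) : bool :=
  if i is Query _ _ _ then true else false.

Section Semantics.
Variables (oracle : nat -> nat -> nat) (tape : seq bool).

Definition step (i : instr) (s : state) : state :=
  let: State r m := s in
  match i with
  | Const x k => State (upd r x k) m
  | Move x y => State (upd r x (r y)) m
  | Add x y z => State (upd r x (r y + r z)) m
  | Sub x y z => State (upd r x (r y - r z)) m
  | Read x y => State (upd r x (m (r y))) m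
  | Write x y => State r (upd m (r x) (r y))
  | Rand x y => State (upd r x (nth false tape (r y))) m
  | Query x y z => State (upd r x (oracle (r y) (r z))) m
  end.

(* [exec c s s' q t]: started in [s], [c] halts in [s'] after [q] queries and
   [t] time units. *)
Inductive exec : program -> state -> state -> nat -> nat -> Prop :=
  | ExecSkip s : exec Skip s s 0 0
  | ExecDo i s : exec (Do i) s (step i s) (is_query i) 1
  | ExecSeq c1 c2 s s1 s2 q1 q2 t1 t2 :
      exec c1 s s1 q1 t1 -> exec c2 s1 s2 q2 t2 ->
      exec (Seq c1 c2) s s2 (q1 + q2) (t1 + t2)
  | ExecIfTrue x c1 c2 s s' q t :
      reg s x != 0 -> exec c1 s s' q t -> exec (If x c1 c2) s s' q t.+1
  | ExecIfFalse x c1 c2 s s' q t :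
      reg s x = 0 -> exec c2 s s' q t -> exec (If x c1 c2) s s' q t.+1
  | ExecWhileTrue x c s s1 s2 q1 q2 t1 t2 :
      reg s x != 0 -> exec c s s1 q1 t1 -> exec (While x c) s1 s2 q2 t2 ->
      exec (While x c) s s2 (q1 + q2) (t1 + t2).+1
  | ExecWhileFalse x c s :
      reg s x = 0 -> exec (While x c) s s 0 1.

End Semantics.

(* A program together with the number of random bits it uses on [n]-vertex
   graphs.  The same random string is used for all queried edges. *)
Record code := Code { prog : program; nbits : nat -> nat }.

(* The real parameters epsilon and delta are not machine words: they select
   the code to be run.  The number of vertices is an input of the program. *)
Definition algorithm (R : realType) := R -> R -> code.

Definition init_state (n a b : nat) : state :=
  State (nth 0 [:: n; a; b]) (fun=> 0).

Definition tape_of (c : code) (G : graph) := (nbits c #|G|).-tuple bool.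

(* On the queried edge (u, v) and random string [w], [c] answers [b] after [q]
   neighbour queries and [t] time units. *)
Definition answers (c : code) (G : graph) (w : tape_of c G) (u v : G)
    (b : bool) (q t : nat) : Prop :=
  exists2 s : state,
    exec (@neighbor_oracle G) w (prog c)
         (init_state #|G| (ident u) (ident v)) s q t
    & (reg s 0 != 0) = b.

Definition prob (R : realType) (T : finType) (p : pred T) : R :=
  (#|p|%:R / #|T|%:R)%R.

Definition local_sparse_spanning_graph (R : realType) (A : algorithm R)
    (eps delta : R) (G : graph) : Prop :=
  let c := A eps delta in
  exists E' : tape_of c G -> {set {set G}},
    [/\ forall w, E' w \subset edges G,
        forall w (u v : G), adj u v ->
          exists q t, answers w u v ([set u; v] \in E' w) q t,
        prob R (fun w => connected (E' w)) = 1%R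
      & (1 - delta <=
         prob R (fun w => (#|E' w|%:R <= (1 + eps) * #|G|%:R :> R)))%R].

Definition query_complexity_le (c : code) (G : graph) (Q : nat) : Prop :=
  forall (w : tape_of c G) (u v : G) b q t,
    adj u v -> answers w u v b q t -> q <= Q.

Definition running_time_le (c : code) (G : graph) (T : nat) : Prop :=
  forall (w : tape_of c G) (u v : G) b q t,
    adj u v -> answers w u v b q t -> t <= T.

(* Main.v *)
Require Import Defs.
From mathcomp Require Import all_boot all_order all_algebra.
From mathcomp Require Import reals sequences exp.
From mathcomp Require Import zify ring lra.
Import Order.TTheory GRing.Theory Num.Theory.

(** Order the edges [{u, v}], [ident u < ident v], lexicographically by
    [(ident u, ident v)], and drop an edge iff it is the least edge of a closed
    walk inside the ball of radius [r = rf beta] around its endpoint [u].  As in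
    Kruskal's algorithm the remaining graph is connected.

    For sparsity, peel off clusters.  In the subgraph induced on the remaining
    vertices, grow balls [B_0, B_1, ...] around a vertex.  As [|B_i| <= exp (beta r)]
    for [i = ceil (r / 2)], some layer [L = B_{i+1} \ B_i] with [i < ceil (r / 2)]
    satisfies [|L| <= 2 beta |B_{i+1}|]; remove [B_{i+1}].  The edges that meet
    [L] number at most [d |L| <= eps |B_{i+1}|].  Since [B_i] has diameter at most
    [r], it lies in the ball searched from each of its vertices, so the kept
    edges inside it form a forest.  Charging the inner boundary [L] to [B_{i+1}]
    rather than to [B_i] is what makes half of the radius [r] sufficient.

    The decision for one edge is made by a breadth-first search of the ball,
    followed by a search of the part reached by larger edges.  The machine
    addresses its memory by vertex ids, so both take time [O(d |ball|)]. *)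

Set Implicit Arguments.
Unset Strict Implicit.
Unset Printing Implicit Defensive.

(** * The spanning subgraph *)

Section Spanner.
Variable G : graph.
Implicit Types (u v w x y : G) (S U : {set G}).

Lemma adj_sym : symmetric (@adj G).
Proof. by move=> u v; rewrite /adj nbrs_sym. Qed.

Lemma adj_irrefl u : adj u u = false.
Proof. by rewrite /adj (negbTE (nbrs_irrefl u)). Qed.

Lemma ballP k x y :
  reflect (exists2 p, path (@adj G) x p & size p <= k /\ last x p = y)
          (y \in ball k x).
Proof.
rewrite inE; apply: (iffP existsP) => [[i /existsP[p /andP[xp /eqP <-]]]|].
  by exists p => //; rewrite size_tuple -ltnS.
move=> [p xp [sp lp]]; have sp' : size p < k.+1 by [].
by exists (Ordinal sp'); apply/existsP; exists (in_tuple p); rewrite xp lp eqxx.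
Qed.

Lemma ball_refl k x : x \in ball k x.
Proof. by apply/ballP; exists [::]. Qed.

Lemma ball0 x : ball 0 x = [set x].
Proof.
apply/setP=> y; rewrite inE; apply/ballP/eqP => [[[|? ?] _ [// _ <-]]|->] //.
by exists [::].
Qed.

Lemma ball_trans j k x y z : y \in ball j x -> z \in ball k y ->
  z \in ball (j + k) x.
Proof.
move=> /ballP[p xp [sp <-]] /ballP[p' yp [sp' <-]].
apply/ballP; exists (p ++ p'); first by rewrite cat_path xp.
by rewrite size_cat last_cat leq_add.
Qed.

Lemma ball1_adj x y : adj x y -> y \in ball 1 x.
Proof. by move=> xy; apply/ballP; exists [:: y]; rewrite //= xy. Qed.

Lemma ball_leq j k x : j <= k -> ball j x \subset ball k x.
Proof.
move=> jk; apply/subsetP=> y /ballP[p xp [sp lp]].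
by apply/ballP; exists p => //; split=> //; apply: leq_trans jk.
Qed.

Lemma ballSP k x y :
  (y \in ball k.+1 x) <-> (y = x \/ exists2 z, adj x z & y \in ball k z).
Proof.
split=> [/ballP[[|z p] /= xp [sp lp]]|[->|[z xz zy]]].
- by left.
- by case/andP: xp => xz zp; right; exists z => //; apply/ballP; exists p.
- exact: ball_refl.
- by rewrite -add1n; apply: ball_trans zy; apply: ball1_adj.
Qed.

Lemma ball_sym k x y : y \in ball k x -> x \in ball k y.
Proof.
elim: k x y => [|k IH] x y; first by rewrite !ball0 !inE eq_sym.
case/ballSP => [->|[z xz /IH zy]]; first exact: ball_refl.
rewrite -addn1; apply: ball_trans zy _; apply: ball1_adj; by rewrite adj_sym.
Qed.

(** Only the head [y] is tested: the walks considered start in the ball at a vertex above [u], so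
    all their edges have both ends above [u]. *)
Definition light_rel (r : nat) u : rel G :=
  fun x y => [&& adj x y, y \in ball r u & ident u < ident y].

(* The edges larger than [{u, v}] are those between vertices above [u] and
   those from [u] to a vertex above [v]. *)
Definition bypassed (r : nat) u v : bool :=
  [exists w, [&& adj u w, w \in ball r u, ident v < ident w
               & connect (light_rel r u) w v]].

Definition spanner_pairs (r : nat) : {set G * G} :=
  [set p | [&& adj p.1 p.2, ident p.1 < ident p.2 & ~~ bypassed r p.1 p.2]].

Definition spanner (r : nat) : {set {set G}} :=
  [set [set p.1; p.2] | p in spanner_pairs r].

Lemma set2_ident_inj u v u' v' : ident u < ident v -> ident u' < ident v' ->
  [set u; v] = [set u'; v'] -> u = u' /\ v = v'.
Proof.
move=> uv uv' /setP E.
move: (E u) (E v) (E u') (E v'); rewrite !inE !eqxx !orbT /=.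
by do 4![case: eqP => [?|?] //=] => *; subst => //; lia.
Qed.

Lemma spannerE r u v : adj u v -> ident u < ident v ->
  ([set u; v] \in spanner r) = ~~ bypassed r u v.
Proof.
move=> uv luv; apply/imsetP/idP => [[[a b]]|nb].
  rewrite inE /= => /and3P[ab lab nb] E.
  by have [-> ->] := set2_ident_inj luv lab E.
by exists (u, v) => //; rewrite inE /= uv luv.
Qed.

Lemma spanner_sub r : spanner r \subset edges G.
Proof.
apply/subsetP=> _ /imsetP[[u v] + ->]; rewrite inE /= => /and3P[uv _ _].
by apply/imsetP; exists (u, v) => //; rewrite inE.
Qed.

Lemma edge_rel_sym F : symmetric (@edge_rel G F).
Proof. by move=> u v; rewrite /edge_rel setUC. Qed.

Lemma ident_leq_max u : ident u <= \max_(x : G) ident x.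
Proof. exact: (leq_bigmax u). Qed.

(* Descending induction on [(ident u, ident v)]: all edges of the closed walk
   that bypasses [{u, v}] are larger. *)
Lemma spanner_edge_connect r u v : adj u v -> ident u < ident v ->
  connect (edge_rel (spanner r)) u v.
Proof.
set m := \max_(x : G) ident x.
have csym := sym_connect_sym (edge_rel_sym (spanner r)).
have [k] := ubnP (m - ident u); elim: k u v => // k IHk u v.
rewrite ltnS => uk; have [j] := ubnP (m - ident v).
elim: j v => // j IHj v; rewrite ltnS => vj uv luv.
case byp: (bypassed r u v); last first.
  by apply: connect1; rewrite /edge_rel spannerE // byp.
case/existsP: byp => w /and4P[uw _ lvw /connectP[p]].
have lw := ident_leq_max w.
(* The edge [{u, w}] exceeds [{u, v}] in its second component, so the inner induction applies to it.
   The edges of the walk from [w] have both ends above [u] and fall under the outer one. *)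
move=> wp vE; apply: (@connect_trans _ _ w).
  by apply: IHj => //; [rewrite -/m in lw; lia | lia].
have luw : ident u < ident w by lia.
rewrite vE; elim: p w {uw lvw vE lw} luw wp => //= x p IHp w luw.
case/andP=> /and3P[wx _ lux] xp.
apply: (@connect_trans _ _ x); last exact: IHp.
have lw := ident_leq_max w; have lx := ident_leq_max x.
rewrite -/m in lw lx.
case: (ltngtP (ident w) (ident x)) => [lt|lt|/ident_inj eq].
- by apply: IHk => //; lia.
- by rewrite csym; apply: IHk; rewrite 1?adj_sym //; lia.
- by rewrite eq adj_irrefl in wx.
Qed.

Lemma spanner_connected r : connected (edges G) -> connected (spanner r).
Proof.
case/andP=> G0 /forallP cG; rewrite /connected G0 /=.
apply/forallP=> u; apply/forallP=> v; have /forallP/(_ v) := cG u.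
apply: connect_sub => {}u {}v; case/imsetP=> -[a b].
rewrite inE /= => ab E.
have uv : adj u v.
  have uE : u \in [set a; b] by rewrite -E set21.
  have vE : v \in [set a; b] by rewrite -E set22.
  have : b \in [set u; v] by rewrite E set22.
  have : a \in [set u; v] by rewrite E set21.
  case/set2P: uE => ->; case/set2P: vE => ->; rewrite ?setUid ?inE //.
  - by move=> _ /eqP ba; rewrite ba in ab.
  - by rewrite adj_sym.
  - by move=> /eqP ba; rewrite ba in ab.
case: (ltngtP (ident u) (ident v)) => [lt|lt|/ident_inj eq].
- exact: spanner_edge_connect.
- rewrite (sym_connect_sym (edge_rel_sym _)).
  by apply: spanner_edge_connect; rewrite // adj_sym.
- by rewrite eq adj_irrefl in uv.
Qed.

(** * Kept edges inside a cluster of small diameter *)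

Section Cluster.
Variables (r : nat) (S : {set G}).
Hypothesis S_ball : {in S &, forall x y, y \in ball r x}.

(** A symmetric counterpart of [light_rel], confined to [S], so that one can speak of its
    components. *)
Let above u : rel G := fun x y =>
  [&& adj x y, x \in S, y \in S, ident u < ident x & ident u < ident y].

Let above_sym u : symmetric (above u).
Proof. by move=> x y; rewrite /above adj_sym; do !bool_congr. Qed.

Let csym u := sym_connect_sym (@above_sym u).

(** The ball condition is automatic, since all of [S] lies within distance [r] of [u]. *)
Let above_light u x y : u \in S ->
  connect (above u) x y -> connect (light_rel r u) x y.
Proof.
move=> uS; apply: connect_sub => a b /and5P[ab aS bS _ ub].
by apply: connect1; rewrite /light_rel ab ub S_ball.
Qed.

Let above_in u x y : connect (above u) x y -> x \in S -> ident u < ident x ->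
  y \in S /\ ident u < ident y.
Proof.
case/connectP=> p + ->; elim: p x => //= z p IHp x /andP[/and5P[_ _ zS _ uz] zp] _ _.
exact: IHp.
Qed.

Let leader (p : G * G) : G :=
  [arg min_(x < p.2 | connect (above p.1) p.2 x) ident x].

(* An edge [{u, v}] is charged to the least vertex of the component of [v] in
   the subgraph induced on the vertices of the cluster above [u]; once [u] is
   added, that vertex is no longer least in its component. *)
Lemma cluster_pairs :
  #|[set p in spanner_pairs r | (p.1 \in S) && (p.2 \in S)]| <= #|S|.
Proof.
set E := [set p in _ | _].
have EP p : p \in E -> [/\ adj p.1 p.2, ident p.1 < ident p.2,
    ~~ bypassed r p.1 p.2, p.1 \in S & p.2 \in S].
  by rewrite !inE => /andP[/and3P[-> -> ->] /andP[-> ->]].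
have leadP p : connect (above p.1) p.2 (leader p) /\
    forall x, connect (above p.1) p.2 x -> ident (leader p) <= ident x.
  by rewrite /leader; case: arg_minnP => [|x]; [exact: connect0|split].
have leadS p : p \in E -> leader p \in S /\ ident p.1 < ident (leader p).
  by move=> /EP[_ lp _ _ pS]; apply: above_in lp => //; have [] := leadP p.
suff inj : {in E &, injective leader}.
  rewrite -(card_in_imset inj); apply: subset_leq_card.
  by apply/subsetP=> _ /imsetP[p /leadS[pS _] ->].
(* If [p'.1] were below [p.1], the edge [p] would put [p.1] into the component of [p'], whose least
   vertex, the common leader, is above [p.1]. *)
have lt_lead p p' : p \in E -> p' \in E -> leader p = leader p' ->
    ident p.1 <= ident p'.1.
  move=> pE p'E eq; rewrite leqNgt; apply/negP => lt.
  have [ad lp _ p1S p2S] := EP _ pE; have [_ lpl] := leadS _ pE.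
  have [cp _] := leadP p; have [cp' min'] := leadP p'.
  suff /min' : connect (above p'.1) p'.2 p.1 by rewrite -eq; lia.
  apply: connect_trans cp' _; rewrite -eq csym.
  apply: (@connect_trans _ _ p.2).
    apply: connect1; rewrite /above ad p1S p2S lt /=; lia.
  apply: connect_sub cp => a b /and5P[ab aS bS la lb].
  by apply: connect1; rewrite /above ab aS bS /=; apply/andP; split; lia.
(* The walk from [p.1] to [p'.2], on to the common leader and back to [p.2] bypasses [p]. *)
have no_lt p p' : p \in E -> p' \in E -> leader p = leader p' ->
    p.1 = p'.1 -> ident p.2 < ident p'.2 -> False.
  move=> pE p'E eq eq1 lt; have [_ _ /negP nb p1S _] := EP _ pE; apply: nb.
  have [ad' _ _ _ p2S'] := EP _ p'E.
  have [cp _] := leadP p; have [cp' _] := leadP p'.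
  apply/existsP; exists p'.2; rewrite eq1 ad' -eq1 S_ball // lt /=.
  by apply: above_light => //; rewrite csym; apply: connect_trans cp _;
    rewrite eq csym eq1.
move=> p p' pE p'E eq.
have eq1 : p.1 = p'.1.
  by apply: ident_inj; apply/eqP; rewrite eqn_leq !lt_lead.
have eq2 : p.2 = p'.2.
  apply: ident_inj; case: (ltngtP (ident p.2) (ident p'.2)) => // lt.
    by case: (no_lt p p').
  by case: (no_lt p' p).
by case: p p' eq1 eq2 {pE p'E eq} => [a b] [a' b'] /= -> ->.
Qed.

End Cluster.

(** Each counted pair arises by sorting some [x] in [L] and one of its at most [d] neighbours by
    id. *)
Lemma pairs_at_card r d (L : {set G}) : degree_bounded G d ->
  #|[set p in spanner_pairs r | (p.1 \in L) || (p.2 \in L)]| <= d * #|L|.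
Proof.
move=> deg; pose orient x y := if ident x < ident y then (x, y) else (y, x).
apply: (@leq_trans #|\bigcup_(x in L) [set orient x y | y in nbrs x]|).
  apply/subset_leq_card/subsetP => -[a b]; rewrite !inE /=.
  case/andP=> /and3P[ab lt _] /orP[aL|bL]; apply/bigcupP.
    by exists a => //; apply/imsetP; exists b; rewrite // /orient lt.
  exists b => //; apply/imsetP; exists a; first by rewrite -nbrs_sym.
  by rewrite /orient ltnNge (ltnW lt).
rewrite mulnC -sum_nat_const.
elim/big_rec2: _ => [|x n B _ Bn]; first by rewrite cards0.
apply: leq_trans (leq_card_setU _ _) _; apply: leq_add Bn.
apply: leq_trans (leq_imset_card _ _) _.
exact: leq_trans (card_size _) (deg x).
Qed.

(** * Sparse layers and the number of kept edges *)

Section Peel.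
Variables (U : {set G}) (c : G).

(** For [c] in [U], the ball of radius [i] in the subgraph induced on [U]: walks through removed
    vertices do not count. *)
Fixpoint grow (i : nat) : {set G} :=
  if i is i'.+1 then
    grow i' :|: [set y in U | [exists x in grow i', adj x y]]
  else [set c].

Lemma grow_ball i : grow i \subset ball i c.
Proof.
elim: i => [|i /subsetP IH]; first by rewrite ball0.
apply/subsetP=> y; rewrite /= in_setU => /orP[/IH|].
  exact: (subsetP (ball_leq _ _)).
rewrite inE => /andP[_ /exists_inP[x xi xy]].
rewrite -addn1; apply: (@ball_trans _ _ _ x); [exact: IH|exact: ball1_adj].
Qed.

Lemma grow_sub i : c \in U -> grow i \subset U.
Proof.
move=> cU; elim: i => [|i IH] /=; first by rewrite sub1set.
by rewrite subUset IH; apply/subsetP => y; rewrite inE => /andP[].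
Qed.

Lemma grow_gt0 i : 0 < #|grow i|.
Proof.
apply/card_gt0P; exists c; elim: i => [|i IH]; first by rewrite inE.
by rewrite /= inE IH.
Qed.

(** Otherwise each step multiplies the size by more than [expR (2 * beta)], because
    [1 - 2 * beta <= expR (- (2 * beta))]. As [2 * uphalf r >= r], the last set would outgrow the
    ball of radius [r]. *)
Lemma sparse_layer (R : realType) (beta : R) r : 0 < r ->
  (#|ball r c|%:R <= expR (beta * r%:R))%R -> (0 <= beta)%R ->
  exists2 i, i < uphalf r &
    ((#|grow i.+1| - #|grow i|)%:R <= 2 * beta * #|grow i.+1|%:R)%R.
Proof.
move=> r0 hr b0.
have mono i : #|grow i| <= #|grow i.+1| by apply: subset_leq_card; apply: subsetUl.
case: (boolP [exists i : 'I_(uphalf r),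
  (#|grow i.+1| - #|grow i|)%:R <= 2 * beta * #|grow i.+1|%:R]%R).
  by case/existsP=> i hi; exists (i : nat).
move=> /existsPn hall; exfalso.
have lt i : i < uphalf r -> (#|grow i|%:R * expR (2 * beta) < #|grow i.+1|%:R :> R)%R.
  move=> ir; have := hall (Ordinal ir); rewrite -ltNge /= natrB // => h.
  have h1 := expR_ge1Dx (- (2 * beta)).
  have g0 : (0 <= #|grow i.+1|%:R :> R)%R by [].
  have : (#|grow i|%:R < expR (- (2 * beta)) * #|grow i.+1|%:R :> R)%R by nra.
  by rewrite expRN mulrC ltr_pdivlMr ?expR_gt0 //.
have ge i : i <= uphalf r -> (expR (2 * beta * i%:R) <= #|grow i|%:R :> R)%R.
  elim: i => [_|i IH ir]; first by rewrite mulr0 expR0 /= cards1.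
  apply/ltW/(le_lt_trans _ (lt _ ir)); rewrite -[i.+1%:R%R]natr1 mulrDr mulr1 expRD.
  by rewrite ler_pM2r ?expR_gt0 // IH // ltnW.
have r1 : 0 < uphalf r by lia.
(* [ge] is an equality at [i = 0], so strictness is taken from the last growth step, which exists
   because [0 < r]. *)
have h1 : (expR (beta * r%:R) < #|grow (uphalf r)|%:R :> R)%R.
  rewrite -(prednK r1); apply: le_lt_trans (lt _ _); last by rewrite prednK.
  apply: (@le_trans _ _ (expR (2 * beta * (uphalf r).-1%:R) * expR (2 * beta)))%R.
    rewrite -expRD ler_expR -{2}(mulr1 (2 * beta)%R) -mulrDr natr1 prednK //.
    rewrite -mulrA mulrCA ler_wpM2l // -natrM ler_nat; lia.
  by rewrite ler_pM2r ?expR_gt0 // ge // leq_pred.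
have : (#|grow (uphalf r)|%:R <= #|ball r c|%:R :> R)%R.
  rewrite ler_nat; apply: subset_leq_card; apply: subset_trans (grow_ball _) _.
  by apply: ball_leq; lia.
by move=> /(lt_le_trans h1)/lt_le_trans/(_ hr); rewrite ltxx.
Qed.

End Peel.

Lemma spanner_pairs_sparse (R : realType) (beta : R) r d (U : {set G}) :
  degree_bounded G d -> 0 < r -> (0 <= beta)%R ->
  (forall c : G, #|ball r c|%:R <= expR (beta * r%:R))%R ->
  (#|[set p in spanner_pairs r | (p.1 \in U) && (p.2 \in U)]|%:R
     <= (1 + 2 * beta * d%:R) * #|U|%:R :> R)%R.
Proof.
move=> deg r0 b0 hr; have [n] := ubnP #|U|; elim: n U => // n IH U; rewrite ltnS => Un.
have [->|[c cU]] := set_0Vmem U.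
  have -> : [set p in spanner_pairs r | (p.1 \in set0) && (p.2 \in set0)] = set0.
    by apply/setP=> p; rewrite [LHS]inE [RHS]inE in_set0 andbF.
  by rewrite !cards0 mulr0.
have [i ir hi] := sparse_layer U r0 (hr c) b0.
set S := grow U c i in hi; set T := grow U c i.+1 in hi.
have ST : S \subset T by apply: subsetUl.
have TU : T \subset U by apply: grow_sub.
have cT : #|T :\: S| = #|T| - #|S| by rewrite cardsD (setIidPr ST).
have cU' : #|U :\: T| = #|U| - #|T| by rewrite cardsD (setIidPr TU).
have T0 : 0 < #|T| := grow_gt0 U c i.+1.
have leST := subset_leq_card ST; have leTU := subset_leq_card TU.
have toT x y : x \in S -> y \in U -> adj x y -> y \in T.
  move=> xS yU xy; rewrite /T /= !inE yU; apply/orP; right.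
  by apply/exists_inP; exists x.
(* Two vertices of [S] are joined through [c] by a walk of length at most [2 * i], and
   [i < uphalf r] gives [2 * i <= r]. *)
have hS : {in S &, forall x y, y \in ball r x}.
  have SB x : x \in S -> x \in ball i c by apply: (subsetP (grow_ball _ _ _)).
  move=> x y /SB/ball_sym xc /SB cy.
  by apply: (subsetP (ball_leq _ _) _ (ball_trans xc cy)); lia.
have h1 := cluster_pairs hS.
have h2 := pairs_at_card r (T :\: S) deg.
have h3 := IH (U :\: T) ltac:(lia).
have adjE p : p \in spanner_pairs r -> adj p.1 p.2 by rewrite inE => /and3P[].
move: (spanner_pairs r) h1 h2 h3 adjE => E h1 h2 h3 adjE.
clearbody S T.
(* Three classes suffice: by [toT], no edge joins [S] to [U :\: T]. *)
have sub : [set p in E | (p.1 \in U) && (p.2 \in U)] \subset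
    [set p in E | (p.1 \in S) && (p.2 \in S)]
    :|: [set p in E | (p.1 \in T :\: S) || (p.2 \in T :\: S)]
    :|: [set p in E | (p.1 \in U :\: T) && (p.2 \in U :\: T)].
  apply/subsetP=> -[a b]; rewrite !inE /= => /andP[abE /andP[aU bU]].
  have ab : adj a b := adjE _ abE.
  rewrite abE aU bU /= !andbT.
  case aS: (a \in S); case bS: (b \in S); rewrite //= ?orbT.
  - by rewrite (toT a b).
  - by rewrite (toT b a) // adj_sym.
  - by case: (a \in T); case: (b \in T).
have h4 := leq_trans (subset_leq_card sub)
  (leq_trans (leq_card_setU _ _) (leq_add (leq_card_setU _ _) (leqnn _))).
rewrite cT in h2; rewrite cU' natrB // in h3.
have h5 : (#|[set p in E | (p.1 \in U) && (p.2 \in U)]|%:R <=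
    #|S|%:R + d%:R * (#|T| - #|S|)%:R + (1 + 2 * beta * d%:R) * (#|U|%:R - #|T|%:R) :> R)%R.
  apply: le_trans (lerD (lexx _) h3).
  rewrite -natrM -!natrD ler_nat; apply: leq_trans h4 _.
  by rewrite leq_add2r leq_add.
(* By [hi] and [S \subset T], the first two terms are at most [(1 + 2 * beta * d) * #|T|]. *)
apply: le_trans h5 _.
have d0 : (0 <= d%:R :> R)%R by [].
have : (#|S|%:R <= #|T|%:R :> R)%R by rewrite ler_nat.
by nra.
Qed.

Lemma spanner_sparse (R : realType) (beta : R) r d :
  degree_bounded G d -> 0 < r -> (0 <= beta)%R ->
  (forall c : G, #|ball r c|%:R <= expR (beta * r%:R))%R ->
  (#|spanner r|%:R <= (1 + 2 * beta * d%:R) * #|G|%:R :> R)%R.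
Proof.
move=> deg r0 b0 hr; have := spanner_pairs_sparse setT deg r0 b0 hr.
rewrite cardsT; apply: le_trans; rewrite ler_nat.
apply: leq_trans (leq_imset_card _ _) _; apply: subset_leq_card.
by apply/subsetP=> p pE; rewrite inE pE !inE.
Qed.

End Spanner.

(** * Executions of programs *)

(** Straight-line code is kept folded, so that [runs_block] evaluates it at once as a [foldl] of
    [step]. *)
Fixpoint block (l : seq instr) : program :=
  if l is i :: l' then Seq (Do i) (block l') else Skip.

Arguments block : simpl never.

Section Runs.
Variables (oracle : nat -> nat -> nat) (tape : seq bool).
Local Notation exec := (exec oracle tape).
Local Notation step := (step oracle tape).

Lemma exec_query_le_time c s s' q t : exec c s s' q t -> q <= t.
Proof.
by elim=> // {c s s' q t} [[]||||] *; lia.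
Qed.

(** Lets a bound proved for one constructed run hold for every run, as the complexity predicates
    demand. *)
Lemma exec_deterministic c s s1 q1 t1 : exec c s s1 q1 t1 ->
  forall s2 q2 t2, exec c s s2 q2 t2 -> [/\ s2 = s1, q2 = q1 & t2 = t1].
Proof.
elim=> {c s s1 q1 t1}.
- by move=> s s2 q2 t2 H; inversion H.
- by move=> i s s2 q2 t2 H; inversion H; subst.
- move=> c1 c2 s s1 s2 q1 q2 t1 t2 _ IH1 _ IH2 s3 q3 t3 H.
  inversion H as [| |? ? ? ? ? ? ? ? ? e1 e2| | | |]; subst.
  by have [? ? ?] := IH1 _ _ _ e1; subst; have [-> -> ->] := IH2 _ _ _ e2.
- move=> x c1 c2 s s' q t nz _ IH s3 q3 t3 H.
  inversion H as [| | |? ? ? ? ? ? ? nz' e|? ? ? ? ? ? ? z e| |]; subst.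
    by have [-> -> ->] := IH _ _ _ e.
  by rewrite z in nz.
- move=> x c1 c2 s s' q t z _ IH s3 q3 t3 H.
  inversion H as [| | |? ? ? ? ? ? ? nz e|? ? ? ? ? ? ? z' e| |]; subst.
    by rewrite z in nz.
  by have [-> -> ->] := IH _ _ _ e.
- move=> x c s s1 s2 q1 q2 t1 t2 nz _ IH1 _ IH2 s3 q3 t3 H.
  inversion H as [| | | | |? ? ? ? ? ? ? ? ? nz' e1 e2|? ? ? z]; subst.
    by have [? ? ?] := IH1 _ _ _ e1; subst; have [-> -> ->] := IH2 _ _ _ e2.
  by rewrite z in nz.
- move=> x c s z s3 q3 t3 H.
  inversion H as [| | | | |? ? ? ? ? ? ? ? ? nz|]; subst=> //.
  by rewrite z in nz.
Qed.

(** Total correctness with a postcondition on final state and time. Queries are not tracked, being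
    bounded by the time. *)
Definition runs (c : program) (s : state) (Q : state -> nat -> Prop) : Prop :=
  exists s' q t, exec c s s' q t /\ Q s' t.

Lemma runs_mono c s (Q Q' : state -> nat -> Prop) :
  (forall s' t, Q s' t -> Q' s' t) -> runs c s Q -> runs c s Q'.
Proof. by move=> QQ' [s' [q [t [? /QQ' ?]]]]; exists s', q, t. Qed.

Lemma runs_skip s (Q : state -> nat -> Prop) : Q s 0 -> runs Skip s Q.
Proof. by move=> ?; exists s, 0, 0; split=> //; constructor. Qed.

Lemma runs_seq c1 c2 s (Q : state -> nat -> Prop) :
  runs c1 s (fun s1 t1 => runs c2 s1 (fun s2 t2 => Q s2 (t1 + t2))) ->
  runs (Seq c1 c2) s Q.
Proof.
move=> [s1 [q1 [t1 [e1 [s2 [q2 [t2 [e2 HQ]]]]]]]].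
by exists s2, (q1 + q2), (t1 + t2); split=> //; apply: ExecSeq e1 e2.
Qed.

Lemma runs_if x c1 c2 s (Q : state -> nat -> Prop) :
  (reg s x != 0 -> runs c1 s (fun s' t => Q s' t.+1)) ->
  (reg s x = 0 -> runs c2 s (fun s' t => Q s' t.+1)) ->
  runs (If x c1 c2) s Q.
Proof.
have [z _ /(_ z)|nz /(_ isT) + _] := eqVneq (reg s x) 0;
  move=> [s' [q [t [e HQ]]]]; exists s', q, t.+1; split=> //.
  exact: ExecIfFalse.
exact: ExecIfTrue.
Qed.

Lemma runs_while x c s (Q : state -> nat -> Prop) :
  (reg s x != 0 ->
     runs c s (fun s1 t1 =>
       runs (While x c) s1 (fun s2 t2 => Q s2 (t1 + t2).+1))) ->
  (reg s x = 0 -> Q s 1) ->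
  runs (While x c) s Q.
Proof.
have [z _ /(_ z) HQ|nz /(_ isT) + _] := eqVneq (reg s x) 0.
  by exists s, 0, 1; split=> //; apply: ExecWhileFalse.
move=> [s1 [q1 [t1 [e1 [s2 [q2 [t2 [e2 HQ]]]]]]]].
exists s2, (q1 + q2), (t1 + t2).+1; split=> //; exact: ExecWhileTrue e1 e2.
Qed.

Lemma runs_block l s (Q : state -> nat -> Prop) :
  Q (foldl (fun s i => step i s) s l) (size l) -> runs (block l) s Q.
Proof.
elim: l s Q => [|i l IH] s Q HQ; first exact: runs_skip.
apply: runs_seq; exists (step i s), (is_query i : nat), 1; split.
  exact: ExecDo.
by apply: IH; rewrite add1n.
Qed.

End Runs.

(** * The search program *)

(* Registers 0, 1, 2 hold the inputs [n], [ident u] and [ident v]. *)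
Definition rX := 3.
Definition rI := 4.
Definition rY := 5.
Definition rB := 6.
Definition rT := 7.
Definition rA := 8.
Definition rM := 9.
Definition rP := 10.
Definition rN := 11.
Definition rTail := 12.
Definition rHead := 13.
Definition rEnd := 14.
Definition rOne := 15.
Definition rTwo := 16.
Definition rF := 17.

(** [rY] holds the id plus one, or 0, so comparison with [rB] rejects missing neighbours as well as
    small ids. The second [rT] is the absolute difference of the mark and [rP], hence 0 iff they
    agree. *)
Definition visit (i : nat) : program :=
  Seq (block [:: Const rI i; Query rY rX rI; Defs.Sub rT rY rB])
  (If rT
    (Seq (block [:: Add rA rY rY; Read rM rA; Defs.Sub rT rM rP; Defs.Sub rM rP rM;
                    Add rT rT rM])
      (If rT Skip
        (block [:: Write rA rN; Defs.Sub rY rY rOne; Write rTail rY;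
                   Add rTail rTail rTwo])))
    Skip).

Fixpoint scan (d : nat) : program :=
  if d is d'.+1 then Seq (scan d') (visit d') else Skip.

Definition sweep (d e : nat) : program :=
  While rF
    (Seq (block [:: Read rX rHead; Add rHead rHead rTwo])
    (Seq (scan d) (block [:: Defs.Sub rF e rHead]))).

(** Recording the tail before a round restricts it to the current layer. Stopping at an exhausted
    queue keeps the time independent of the radius. *)
Fixpoint layers (d k : nat) : program :=
  if k is k'.+1 then
    Seq (block [:: Move rEnd rTail; Defs.Sub rF rEnd rHead])
      (If rF (Seq (sweep d rEnd) (layers d k')) Skip)
  else Skip.

(* Registers 1 and 2 hold [ident a < ident b].  Marks of vertices: 0 is unseen,
   1 is in the ball, 2 is reached from [a] by edges larger than [{a, b}]; only
   vertices [y] with [rB < ident y + 1] are enqueued. *)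
Definition spanner_search (d r : nat) : program :=
  Seq (block [:: Const rB 0; Const rP 0; Const rN 1; Const rHead 1;
                 Const rTail 1; Add rY 1 rOne; Add rA rY rY; Write rA rN;
                 Write rTail 1; Add rTail rTail rTwo])
  (Seq (layers d r)
  (* The scan of [a] admits only neighbours above [b]; afterwards the threshold drops to [a]. *)
  (Seq (block [:: Const rP 1; Const rN 2; Const rHead 1; Const rTail 1;
                  Add rB 2 rOne; Move rX 1])
  (Seq (scan d)
  (Seq (block [:: Add rB 1 rOne; Defs.Sub rF rTail rHead])
  (Seq (sweep d rTail)
       (* The answer is 2 minus the mark of [b], so it is 0 iff [b] was reached. *)
       (block [:: Add rA 2 rOne; Add rA rA rA; Read rM rA; Const rX 2;
                  Defs.Sub 0 rX rM])))))).

Definition spanner_program (d r : nat) : program :=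
  Seq (block [:: Const rOne 1; Const rTwo 2; Defs.Sub rT 1 2])
  (Seq (If rT (block [:: Move rX 1; Move 1 2; Move 2 rX]) Skip)
       (spanner_search d r)).

Lemma in_eq_regs (l : seq nat) (h h' : nat -> nat) :
  all (fun z => h z == h' z) l -> {in l, h =1 h'}.
Proof. by move/allP=> hl z /hl /eqP. Qed.

(** * The search invariant *)

Section Search.
Variable G : graph.
Implicit Types (K : {set G}) (q : seq G) (x y u v w : G).

Lemma neighbor_oracleE x i :
  neighbor_oracle G (ident x) i =
  if i < size (nbrs x) then (ident (nth x (nbrs x) i)).+1 else 0.
Proof.
rewrite /neighbor_oracle; case: pickP => [v /eqP /ident_inj ->|/(_ x)]; last first.
  by rewrite eqxx.
by case: ltnP => h; [rewrite onthE (nth_map x) | rewrite onth_default].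
Qed.

(** The effect of [visit] on the queue, abstracted from the machine. *)
Definition enqueue K (B : nat) q y : seq G :=
  if [&& B < (ident y).+1, y \in K & y \notin q] then rcons q y else q.

(* The mark of [v] is stored at the even address [(ident v).+1.*2], and the
   [j]-th entry of the queue at the odd address [j.*2.+1]. *)
Record search_state K (P B : nat) q (s : state) : Prop := SearchState {
  ss_one : reg s rOne = 1;
  ss_two : reg s rTwo = 2;
  ss_P : reg s rP = P;
  ss_N : reg s rN = P.+1;
  ss_B : reg s rB = B;
  ss_tail : reg s rTail = (size q).*2.+1;
  ss_mark : forall v,
    Defs.mem s (ident v).+1.*2 = if v \in K then P + (v \in q) else 0;
  ss_queue : forall j, j < size q ->
    Defs.mem s j.*2.+1 = nth 0 (map (@ident G) q) j
}.

Variable tape : seq bool.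
Local Notation runs := (runs (neighbor_oracle G) tape).

Section Phase.
Variables (K : {set G}) (P B : nat).
(** Vertices outside [K] carry mark 0, which must not be mistaken for the mark [P] of unreached
    ones. *)
Hypothesis K_marked : forall v, v \notin K -> 0 < P.

(** The time is at most 3 + 5 + 4 instructions and two tests. *)
Lemma visit_runs q s x i :
  search_state K P B q s -> reg s rX = ident x ->
  runs (visit i) s (fun s' t =>
    [/\ t <= 14,
        search_state K P B
          (if i < size (nbrs x) then enqueue K B q (nth x (nbrs x) i) else q) s'
      & {in [:: 1; 2; rX; rHead; rEnd], reg s' =1 reg s}]).
Proof.
case: s => r m [/= h1 h2 hP hN hB ht hm hq] hX.
apply: runs_seq; apply: runs_block => /=; rewrite /upd /= hX hB.
rewrite neighbor_oracleE.
case: ltnP => isz; last first.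
  apply: runs_if; rewrite /= ?sub0n //= => _; apply: runs_skip; split=> //.
  by apply: in_eq_regs; rewrite /= !eqxx.
set y := nth x (nbrs x) i.
apply: runs_if => /= [nz|z]; last first.
  apply: runs_skip; split=> //; last by apply: in_eq_regs; rewrite /= !eqxx.
  by rewrite /enqueue ltnNge -subn_eq0 z /=; constructor.
have Bi : B < (ident y).+1 by rewrite -subn_gt0 lt0n.
apply: runs_seq; apply: runs_block => /=; rewrite /upd /= hP addnn hm.
apply: runs_if => /= [nz'|z'].
  apply: runs_skip; split=> //; last by apply: in_eq_regs; rewrite /= !eqxx.
  suff -> : enqueue K B q y = q by constructor.
  rewrite /enqueue; case: ifP => // /and3P[_ yK yq].
  by move: nz'; rewrite yK (negbTE yq) addn0 subnn.
have [yK yq] : y \in K /\ y \notin q.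
  move: z'; case: ifPn => [_|/K_marked]; last lia.
  by case: (y \in q); lia.
apply: runs_block => /=; split=> //; last by apply: in_eq_regs; rewrite /= !eqxx.
rewrite /enqueue Bi yK yq /=; split; rewrite /upd //=.
- by rewrite ht h2 size_rcons; lia.
- move=> v; rewrite ht h1 hN mem_rcons inE.
  case: eqP => [|_]; first by lia.
  case: eqP => [e|ne].
    have -> : v = y by apply: ident_inj; lia.
    by rewrite yK eqxx /= addn1.
  rewrite hm; suff -> : (v == y) = false by [].
  by apply/eqP => vy; apply: ne; rewrite vy.
- move=> j; rewrite ht h1 hN size_rcons map_rcons nth_rcons size_map.
  case: (ltngtP j (size q)) => [lt _|lt|-> _]; last by rewrite eqxx subn1.
    case: eqP => [|_]; first by lia.
    by case: eqP => [|_]; [lia|rewrite hq].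
  by rewrite ltnS leqNgt lt.
Qed.

Lemma scan_runs q s x d :
  search_state K P B q s -> reg s rX = ident x ->
  runs (scan d) s (fun s' t =>
    [/\ t <= 14 * d,
        search_state K P B (foldl (enqueue K B) q (take d (nbrs x))) s'
      & {in [:: 1; 2; rX; rHead; rEnd], reg s' =1 reg s}]).
Proof.
move=> hs hX; elim: d => [|d IH] /=; first by apply: runs_skip; rewrite take0.
apply: runs_seq; apply: runs_mono IH => s1 t1 [ht1 hs1 fr1].
have hX1 : reg s1 rX = ident x by rewrite fr1.
apply: runs_mono (visit_runs d hs1 hX1) => s2 t2 [ht2 hs2 fr2]; split.
- lia.
- case: ltnP hs2 => dx; first by rewrite (take_nth x) // foldl_rcons.
  by rewrite !take_oversize // ltnW.
- by move=> z hz; rewrite fr2 // fr1.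
Qed.

Lemma mem_enqueue q l y :
  (y \in foldl (enqueue K B) q l) =
  (y \in q) || [&& y \in l, B < (ident y).+1 & y \in K].
Proof.
elim: l q => [|z l IH] q /=; first by rewrite orbF.
rewrite IH /enqueue inE; case: (eqVneq y z) => [->|ne] /=.
  case: ifP => [/and3P[-> -> _]|]; first by rewrite mem_rcons inE eqxx orbT.
  by case: (z \in q) => //=; rewrite andbT => ->; rewrite andbF.
by case: ifP => _; rewrite // mem_rcons inE (negbTE ne).
Qed.

Lemma enqueue_uniq q l : uniq q -> uniq (foldl (enqueue K B) q l).
Proof.
elim: l q => //= z l IH q uq; apply: IH; rewrite /enqueue.
by case: ifP => // /and3P[_ _ zq]; rewrite rcons_uniq zq.
Qed.

Lemma enqueue_prefix q l : prefix q (foldl (enqueue K B) q l).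
Proof.
elim: l q => [|z l IH] q /=; first exact: prefix_refl.
apply: prefix_trans (IH _); rewrite /enqueue.
by case: ifP => _; rewrite ?prefix_rcons ?prefix_refl.
Qed.

(* With [dyn] the queue is swept until it is exhausted, otherwise only up to
   the position [e] recorded in [rEnd]. *)
Lemma sweep_runs (dyn : bool) (e d : nat) (Phi : seq G -> nat -> Prop) :
  let lim q := if dyn then size q else e in
  degree_bounded G d -> 0 < d ->
  (forall q h x, uniq q -> h < lim q <= size q -> Phi q h -> nth x q h = x ->
     Phi (foldl (enqueue K B) q (nbrs x)) h.+1) ->
  forall q h s, search_state K P B q s -> reg s rHead = h.*2.+1 ->
  reg s rF = (lim q - h).*2 -> (dyn || (reg s rEnd == e.*2.+1)) ->
  h <= lim q <= size q -> uniq q -> Phi q h ->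
  runs (sweep d (if dyn then rTail else rEnd)) s (fun s' t =>
    exists q', [/\ search_state K P B q' s' /\ uniq q',
      lim q' <= size q' /\ reg s' rHead = (lim q').*2.+1,
      h <= lim q' /\ t <= 18 * d * (lim q' - h) + 1,
      Phi q' (lim q') & {in [:: 1; 2], reg s' =1 reg s}]).
Proof.
move=> lim deg d0 step.
have size_le q : uniq q -> size q <= #|G| by move=> uq; rewrite -(card_uniqP uq) max_card.
(* The measure works because a queue without repetitions has at most [#|G|] entries. *)
move=> q h; have [n] := ubnP (#|G| - h).
elim: n q h => // n IH q h; rewrite ltnS => hn s hs hh hF he /andP[hl ls] uq hq.
apply: runs_while => [nz|z]; last first.
  have lE : lim q = h by lia.
  by exists q; rewrite lE in ls *; rewrite subnn; split=> //; split=> //; lia.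
have {nz} lt : h < lim q by lia.
have qh : h < size q by apply: leq_trans ls.
have [x0 _] : exists x0, x0 \in q by case: (q) qh => // y ? _; exists y; rewrite inE eqxx.
pose x := nth x0 q h; have xE : nth x q h = x by apply: set_nth_default.
apply: runs_seq; apply: runs_block.
set s1 := foldl _ _ _.
have hs1 : search_state K P B q s1.
  rewrite /s1; case: (s) hs => r m [/= *]; split=> //=.
have hX : reg s1 rX = ident x.
  rewrite /s1; case: (s) hs hh => r m [/= _ _ _ _ _ _ _ hqu] hh.
  by rewrite /upd /= hh hqu // (nth_map x0).
have hh1 : reg s1 rHead = h.+1.*2.+1.
  by rewrite /s1; case: (s) hs hh => r m [/= _ h2 *]; rewrite /upd /=; lia.
have fr1 : {in [:: 1; 2; rEnd], reg s1 =1 reg s}.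
  by rewrite /s1; case: (s) => r m; apply: in_eq_regs; rewrite /= !eqxx.
clearbody s1.
apply: runs_seq; apply: runs_mono (scan_runs d hs1 hX) => s2 t2 [ht2 hs2 fr2].
rewrite take_oversize // in hs2; set q2 := foldl _ _ _ in hs2.
apply: runs_block; set s3 := foldl _ _ _.
have hs3 : search_state K P B q2 s3.
  by rewrite /s3; case: (s2) hs2 => r m [/= *]; split.
have fr3 : {in [:: 1; 2; rEnd; rHead], reg s3 =1 reg s2}.
  by rewrite /s3; case: (s2) => r m; apply: in_eq_regs; rewrite /= !eqxx.
have hE : reg s2 (if dyn then rTail else rEnd) = (lim q2).*2.+1.
  rewrite /lim; case: (dyn) he => /= [_|/eqP he]; first exact: ss_tail hs2.
  by rewrite fr2 // fr1.
have hh2 : reg s2 rHead = h.+1.*2.+1 by rewrite fr2.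
have hF3 : reg s3 rF = (lim q2 - h.+1).*2.
  by rewrite /s3; case: (s2) hE hh2 => r m /= hE hh2; rewrite /upd /= hE hh2; lia.
clearbody s3.
have q2s : size q <= size q2 by apply: size_prefix; apply: enqueue_prefix.
have l2 : h < lim q2 <= size q2.
  by move: ls lt; rewrite /lim; case: (dyn); lia.
have sG := size_le _ uq.
apply: runs_mono (IH q2 h.+1 _ s3 hs3 _ hF3 _ _ _ _) => //.
- move=> s4 t4 [q4 [[hs4 uq4] [l4 hh4] [h4 ht4] hq4 fr4]].
  exists q4; split=> //; last by move=> z hz; rewrite fr4 // fr3 ?fr2 ?fr1 //;
    move: hz; rewrite !inE; case/orP=> ->; rewrite ?orbT.
  split; first lia.
  (* An iteration takes at most [14 * d + 4 <= 18 * d] units. *)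
  have -> : lim q4 - h = (lim q4 - h.+1).+1 by lia.
  rewrite mulnS /=; lia.
- lia.
- by rewrite fr3.
- by case: (dyn) he => //= /eqP <-; rewrite fr3 // fr2 // fr1.
- exact: enqueue_uniq.
- by apply: step => //; rewrite lt.
Qed.

End Phase.

End Search.

(** * Correctness of the search program *)

Section SpannerProgram.
Variables (G : graph) (tape : seq bool) (d : nat).
Hypotheses (deg : degree_bounded G d) (d_gt0 : 0 < d).
Implicit Types (q : seq G) (a b x y u v w : G).
Local Notation runs := (runs (neighbor_oracle G) tape).

(** Once [h] is the length of the queue, this says that the queue is closed under [e]. *)
Definition scanned (e : rel G) q h : Prop :=
  forall x y, x \in take h q -> e x y -> y \in q.

Lemma scanned_step (K : {set G}) (B : nat) (e : rel G) q h x :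
  (forall x y, e x y = [&& adj x y, B < (ident y).+1 & y \in K]) ->
  h < size q -> nth x q h = x -> scanned e q h ->
  scanned e (foldl (enqueue K B) q (nbrs x)) h.+1.
Proof.
move=> eE hq hx sc y z.
have -> : take h.+1 (foldl (enqueue K B) q (nbrs x)) = rcons (take h q) x.
  have /prefixP[l ->] := enqueue_prefix K B q (nbrs x).
  by rewrite takel_cat // (take_nth x) // hx.
rewrite mem_rcons inE mem_enqueue => /predU1P[->|yq].
  by rewrite eE => ->; rewrite orbT.
by move=> yz; rewrite (sc y z).
Qed.

Lemma layers_runs k q h s :
  search_state setT 0 0 q s -> reg s rHead = h.*2.+1 -> h <= size q -> uniq q ->
  scanned (@adj G) q h ->
  runs (layers d k) s (fun s' t =>
    exists q', [/\ search_state setT 0 0 q' s' /\ uniq q',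
      size q <= size q', t <= 22 * d * (size q' - h) + 3,
      {in [:: 1; 2], reg s' =1 reg s}
    & forall y, (y \in q') <-> (exists2 x, x \in q & y \in ball k x)]).
Proof.
elim: k q h s => [|k IH] q h s hs hh hq uq sc /=.
  apply: runs_skip; exists q; split=> // y.
  by split=> [yq|[x xq]]; [exists y; rewrite // ball_refl | rewrite ball0 inE => /eqP ->].
apply: runs_seq; apply: runs_block; set s1 := foldl _ _ _.
have hs1 : search_state setT 0 0 q s1.
  by rewrite /s1; case: (s) hs => r m [/= *]; split.
have fr1 : {in [:: 1; 2; rHead], reg s1 =1 reg s}.
  by rewrite /s1; case: (s) => r m; apply: in_eq_regs; rewrite /= !eqxx.
have he1 : reg s1 rEnd = (size q).*2.+1.
  by rewrite /s1; case: (s) hs => r m [].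
have hf1 : reg s1 rF = (size q - h).*2.
  rewrite /s1; case: (s) hs hh => r m [/= _ _ _ _ _ ht _ _] hh.
  by rewrite /upd /= hh ht; lia.
have hh1 : reg s1 rHead = h.*2.+1 by rewrite fr1.
clearbody s1; apply: runs_if => [nz|z]; last first.
  apply: runs_skip; exists q; split=> //=.
  - lia.
  - by move=> x hx; rewrite fr1 //; move: hx; rewrite !inE => /orP[->|->]; rewrite ?orbT.
  - move=> y; split=> [yq|[x xq]]; first by exists y; rewrite // ball_refl.
    (* The queue is closed under adjacency, so the omitted rounds would add nothing. *)
    have cl a b : a \in q -> adj a b -> b \in q.
      by move=> aq; apply: sc; rewrite take_oversize //; lia.
    elim: k.+1 x xq => [|j IHj] x xq; first by rewrite ball0 inE => /eqP ->.
    by case/ballSP => [->//|[w xw]]; apply: IHj; apply: cl xw.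
have lt : h < size q by lia.
apply: runs_seq.
pose Phi q1 h1 := [/\ prefix q q1,
  forall y, y \in q1 -> y \in q \/ (exists2 x, x \in q & adj x y)
  & scanned (@adj G) q1 h1].
have E0 (x y : G) : adj x y = [&& adj x y, 0 < (ident y).+1 & y \in setT].
  by rewrite inE !andbT.
have step q1 h1 x : uniq q1 -> h1 < size q <= size q1 -> Phi q1 h1 ->
    nth x q1 h1 = x -> Phi (foldl (enqueue setT 0) q1 (nbrs x)) h1.+1.
  move=> uq1 /andP[l1 l2] [pre sub sc1] hx.
  have xq : x \in q.
    have /prefixP[l E] := pre; rewrite -hx E nth_cat l1; exact: mem_nth.
  split; first exact: prefix_trans (enqueue_prefix _ _ _ _).
    by move=> y; rewrite mem_enqueue => /orP[/sub //|/andP[xy _]]; right; exists x.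
  apply: scanned_step E0 _ hx sc1; exact: leq_trans l2.
have Phi0 : Phi q h.
  by split=> //; [exact: prefix_refl | move=> y yq; left].
have := sweep_runs tape (K := setT) (P := 0) (B := 0) (dyn := false) (e := size q) _
  deg d_gt0 step hs1 hh1 hf1 _ _ uq Phi0.
move=> H; apply: runs_mono (H _ _ _) => {H}.
- move=> s2 t2 [q2 [[hs2 uq2] [l2 hh2] [_ ht2] [pre sub sc2] fr2]].
  apply: runs_mono (IH q2 (size q) s2 hs2 hh2 l2 uq2 sc2) => s3 t3.
  move=> [q3 [[hs3 uq3] l3 ht3 fr3 mem3]]; exists q3; split=> //.
  + exact: leq_trans l3.
  + rewrite /=.
    (* A round on [m >= 1] entries costs at most [18 * d * m + 4 <= 22 * d * m]. *)
    have -> : size q3 - h = (size q3 - size q) + (size q - h) by lia.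
    rewrite mulnDr; nia.
  + move=> x hx; rewrite fr3 // fr2 // fr1 //.
    by move: hx; rewrite !inE => /orP[->|->]; rewrite ?orbT.
  + have qq2 x : x \in q -> x \in q2.
      by case/prefixP: pre => l ->; rewrite mem_cat => ->.
    have q2E : take (size q) q2 = q by apply/eqP; rewrite -prefixE.
    move=> y; rewrite mem3; split=> -[x xq].
      move=> xy; case: (sub _ xq) => [xq'|[w wq wx]].
        by exists x => //; apply: (subsetP (ball_leq _ _)) xy.
      by exists w => //; apply/ballSP; right; exists x.
    case/ballSP => [->|[w xw wy]]; first by exists x; rewrite ?qq2 ?ball_refl.
    by exists w => //; apply: sc2 xw; rewrite q2E.
- by move=> v; rewrite inE.
- by rewrite he1 eqxx.
- by rewrite (ltnW lt) leqnn.
Qed.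

Lemma spanner_search_runs r a b s :
  adj a b -> ident a < ident b ->
  reg s 1 = ident a -> reg s 2 = ident b -> reg s rOne = 1 -> reg s rTwo = 2 ->
  (forall j, Defs.mem s j = 0) ->
  runs (spanner_search d r) s (fun s' t =>
    t <= 81 * (d * #|ball r a|) /\
    (reg s' 0 != 0) = ~~ bypassed r a b).
Proof.
move=> ab lab ha hb h1 h2 hm.
apply: runs_seq; apply: runs_block; set s1 := foldl _ _ _.
have hs1 : search_state setT 0 0 [:: a] s1.
  rewrite /s1; case: (s) ha hb h1 h2 hm => rg m /= ha hb h1 h2 hm.
  split; rewrite /upd //=.
  - by rewrite h2.
  - move=> v; rewrite !inE /= ha h1 hm add0n.
    case: eqP => [e|ne].
      have -> : v = a by apply: ident_inj; lia.
      by rewrite eqxx.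
    by case: eqP => // va; case: ne; rewrite va; lia.
  - by case=> // _; rewrite /= ha.
have hh1 : reg s1 rHead = 0.*2.+1 by rewrite /s1; case: (s).
have fr1 : {in [:: 1; 2], reg s1 =1 reg s}.
  by rewrite /s1; case: (s) => rg m; apply: in_eq_regs; rewrite /= !eqxx.
clearbody s1; apply: runs_seq.
apply: runs_mono (layers_runs r hs1 hh1 _ _ _) => //.
move=> s2 t2 [q2 [[hs2 uq2] _ ht2 fr2 mem2]].
have q2E : q2 =i ball r a.
  move=> y; apply/idP/idP => [/mem2[x]|yb]; first by rewrite inE => /eqP ->.
  by apply/mem2; exists a; rewrite ?mem_head.
have sq2 : size q2 = #|ball r a| by rewrite -(card_uniqP uq2); apply: eq_card.
apply: runs_seq; apply: runs_block; set s3 := foldl _ _ _.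
have ha2 : reg s2 1 = ident a by rewrite fr2 // fr1.
have hb2 : reg s2 2 = ident b by rewrite fr2 // fr1.
(* The marks left by the first phase are reused: 1 on the ball, 0 elsewhere, and an empty queue. *)
have hs3 : search_state (ball r a) 1 (ident b).+1 [::] s3.
  rewrite /s3; case: (s2) hs2 ha2 hb2 => rg m [/= g1 g2 _ _ _ _ gm _] ha2 hb2.
  split; rewrite /upd //=; first by rewrite g1 hb2 addn1.
  by move=> v; rewrite gm inE q2E; case: (v \in ball r a).
have hX3 : reg s3 rX = ident a by rewrite /s3; case: (s2) ha2.
have hh3 : reg s3 rHead = 0.*2.+1 by rewrite /s3; case: (s2).
have fr3 : {in [:: 1; 2], reg s3 =1 reg s2}.
  by rewrite /s3; case: (s2) => rg m; apply: in_eq_regs; rewrite /= !eqxx.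
clearbody s3; apply: runs_seq.
have marked v : v \notin ball r a -> 0 < 1 by [].
apply: runs_mono (scan_runs tape marked d hs3 hX3) => s4 t4 [ht4 hs4 fr4].
rewrite take_oversize // in hs4; set q0 := foldl _ _ _ in hs4.
have q0E w : (w \in q0) = [&& adj a w, ident b < ident w & w \in ball r a].
  by rewrite mem_enqueue.
have uq0 : uniq q0 by apply: enqueue_uniq.
clearbody q0.
apply: runs_seq; apply: runs_block; set s5 := foldl _ _ _.
have ha4 : reg s4 1 = ident a by rewrite fr4 // fr3.
have hb4 : reg s4 2 = ident b by rewrite fr4 // fr3.
have hh4 : reg s4 rHead = 0.*2.+1 by rewrite fr4.
have hs5 : search_state (ball r a) 1 (ident a).+1 q0 s5.
  rewrite /s5; case: (s4) hs4 ha4 => rg m [/= g1 *]; split=> //.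
  by rewrite /upd /= g1; lia.
have hh5 : reg s5 rHead = 0.*2.+1 by rewrite /s5; case: (s4) hh4.
have hf5 : reg s5 rF = (size q0 - 0).*2.
  rewrite /s5; case: (s4) hs4 hh4 => rg m [/= _ _ _ _ _ gt _ _] hh4.
  by rewrite /upd /= gt hh4; lia.
have hb5 : reg s5 2 = ident b by rewrite /s5; case: (s4) hb4.
clearbody s5; apply: runs_seq.
pose e := light_rel r a.
have eE (x y : G) : e x y = [&& adj x y, (ident a).+1 < (ident y).+1 & y \in ball r a].
  by rewrite /e /light_rel ltnS [(y \in _) && _]andbC.
pose Phi q h := [/\ {subset q0 <= q}, {subset q <= ball r a},
  forall y, y \in q -> exists2 w, w \in q0 & connect e w y & scanned e q h].
have step q h x : uniq q -> h < size q <= size q -> Phi q h -> nth x q h = x ->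
    Phi (foldl (enqueue (ball r a) (ident a).+1) q (nbrs x)) h.+1.
  move=> _ /andP[hq _] [sub sub' rea sc] hx.
  have xq : x \in q by rewrite -hx; apply: mem_nth.
  split; last exact: scanned_step eE hq hx sc.
  - by move=> w /sub; rewrite mem_enqueue => ->.
  - by move=> w; rewrite mem_enqueue => /orP[/sub'//|/and3P[]].
  - move=> y; rewrite mem_enqueue => /orP[/rea//|xy].
    have [w wq wx] := rea x xq; exists w => //.
    by apply: connect_trans wx (connect1 _); rewrite eE.
have Phi0 : Phi q0 0.
  split=> [//| w | y yq | x y]; last by rewrite take0.
  - by rewrite q0E => /and3P[].
  - by exists y => //; apply: connect0.
have := sweep_runs tape marked (dyn := true) (e := 0)
  deg d_gt0 step hs5 hh5 hf5 isT _ uq0 Phi0.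
move=> /(_ (leqnn _)); apply: runs_mono.
move=> s6 t6 [q6 [[hs6 uq6] _ [_ ht6] [sub sub' rea sc] fr6]].
have hb6 : reg s6 2 = ident b by rewrite fr6.
have sq6 : size q6 <= #|ball r a|.
  by rewrite -(card_uniqP uq6); apply: subset_leq_card; apply/subsetP.
have N0 : 0 < #|ball r a| by apply/card_gt0P; exists a; apply: ball_refl.
(* The constant is 22 (ball) + 18 (sweep) + 14 (scan of [a]) + 27 (fixed overhead). *)
apply: runs_block; split.
  rewrite /= subn0 in ht6 *; rewrite subn0 sq2 in ht2.
  have : d * size q6 <= d * #|ball r a| by rewrite leq_mul2l sq6 orbT.
  have : d * 1 <= d * #|ball r a| by rewrite leq_mul2l N0 orbT.
  rewrite -mulnA in ht6; rewrite -mulnA in ht2; lia.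
case: s6 hs6 hb6 {ht6 fr6} => rg m [/= g1 _ _ _ _ _ gm _] hb6.
rewrite /upd /= hb6 g1 addn1 addnn gm.
(* Queue entries are reachable from [q0], and the final queue is closed under [e]. *)
have -> : bypassed r a b = (b \in q6).
  apply/existsP/idP => [[w /and4P[aw wb bw wcb]]|/rea[w]]; last first.
    by rewrite q0E => /and3P[aw bw wb] wcb; exists w; rewrite aw bw wb.
  have : w \in q6 by apply: sub; rewrite q0E aw bw.
  case/connectP: wcb => p + ->; elim: p w {aw wb bw} => //= z p IHp w /andP[wz zp] wq.
  by apply: IHp => //; apply: sc wz; rewrite take_size.
by case bq: (b \in q6); [rewrite (sub' _ bq) | case: ifP].
Qed.

Lemma spanner_program_runs r u v : adj u v ->
  runs (spanner_program d r) (init_state #|G| (ident u) (ident v)) (fun s t =>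
    t <= 88 * (d * max_ball G r) /\
    (reg s 0 != 0) = ([set u; v] \in spanner G r)).
Proof.
move=> uv.
have bound (x : G) : #|ball r x| <= max_ball G r by apply: (leq_bigmax x).
have N0 : 0 < #|ball r u| by apply/card_gt0P; exists u; apply: ball_refl.
have D0 : 0 < d * max_ball G r by rewrite muln_gt0 d_gt0 (leq_trans N0).
have le (x : G) : d * #|ball r x| <= d * max_ball G r by rewrite leq_mul2l bound orbT.
apply: runs_seq; apply: runs_block => /=; apply: runs_seq.
apply: runs_if; rewrite /= /upd /= -/(upd _) => h.
  have lt : ident v < ident u by lia.
  apply: runs_block => /=.
  apply: runs_mono (@spanner_search_runs r v u _ _ lt _ _ _ _ _) => //=.
  - move=> s t [ht ->]; split; first by have := le v; lia.
    by rewrite setUC spannerE // adj_sym.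
  - by rewrite adj_sym.
have lt : ident u < ident v.
  have ne : ident u <> ident v by move/ident_inj => e; rewrite e adj_irrefl in uv.
  lia.
apply: runs_skip.
apply: runs_mono (@spanner_search_runs r u v _ _ lt _ _ _ _ _) => //=.
move=> s t [ht ->]; split; first by have := le u; lia.
by rewrite spannerE.
Qed.

End SpannerProgram.

(** * Probabilities and the final bounds *)

Lemma prob_true (R : realType) (T : finType) (p : pred T) :
  0 < #|T| -> p =1 predT -> prob R p = 1%R.
Proof.
move=> T0 pT; rewrite /prob (eq_card pT) divff // pnatr_eq0 -lt0n.
by rewrite (eq_card (B := T)).
Qed.

Theorem theorem5 (R : realType) :
  exists C : nat,
  forall (d : nat) (f : nat -> nat) (rf : R -> nat),
    (0 < d)%N ->
    {homo f : m n / (m <= n)%N} ->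
    subexponential_growth f rf ->
  exists A : algorithm R,
  forall (G : graph) (eps delta : R),
    connected (edges G) ->
    degree_bounded G d ->
    growth_bounded G f ->
    (0 < eps)%R ->
    (0 <= delta < 1)%R ->
    let beta : R := (eps / (2 * d%:R))%R in
    [/\ local_sparse_spanning_graph A eps delta G,
        query_complexity_le (A eps delta) G (C * (d * max_ball G (rf beta))),
        running_time_le (A eps delta) G (C * (d * max_ball G (rf beta)))
      & ((d * max_ball G (rf beta))%:R
           <= C%:R * (d%:R * expR (beta * (rf beta)%:R)) :> R)%R].
Proof.
(* The search costs 81 units per [d * #|ball|], and orienting the edge at most 7 more. *)
exists 88 => d f rf d0 _ sub.
(* With zero random bits there is a single random string, so an event that holds has probability
   1. *)
exists (fun eps delta => Code (spanner_program d (rf (eps / (2 * d%:R))%R)) (fun=> 0)).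
move=> G eps delta cG deg gr e0 /andP[del0 _] beta.
have dR : (0 < d%:R :> R)%R by rewrite ltr0n.
have b0 : (0 < beta)%R by rewrite divr_gt0 // mulr_gt0.
have epsE : (2 * beta * d%:R = eps)%R by rewrite /beta; field; rewrite gt_eqF.
have [r0 /(_ _ (leqnn _)) hr] := sub _ b0; rewrite -/beta.
set r := rf beta in r0 hr *.
have mb : ((max_ball G r)%:R <= expR (beta * r%:R) :> R)%R.
  by apply: le_trans hr; rewrite ler_nat; apply: gr.
have time (w : seq bool) (u v : G) s q t : adj u v ->
    exec (neighbor_oracle G) w (spanner_program d r)
      (init_state #|G| (ident u) (ident v)) s q t -> t <= 88 * (d * max_ball G r).
  move=> uv ex; have [s' [q' [t' [ex' [le _]]]]] := spanner_program_runs w deg d0 r uv.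
  by have [_ _ ->] := exec_deterministic ex' ex.
split.
- exists (fun=> spanner G r); split.
  + by move=> _; apply: spanner_sub.
  + move=> w u v uv.
    have [s [q [t [ex [_ hb]]]]] := spanner_program_runs w deg d0 r uv.
    by exists q, t, s.
  + by apply: prob_true => [|w]; rewrite ?card_tuple ?expn_gt0 ?card_bool // spanner_connected.
  + rewrite prob_true ?lerBlDr ?lerDl ?card_tuple ?expn_gt0 ?card_bool // => w.
    rewrite -epsE; apply: spanner_sparse deg r0 (ltW b0) _ => c.
    by apply: le_trans mb; rewrite ler_nat; apply: (leq_bigmax c).
- move=> w u v b q t uv [s ex _].
  exact: leq_trans (exec_query_le_time ex) (time _ _ _ _ _ _ uv ex).
- by move=> w u v b q t uv [s ex _]; apply: time uv ex.
- rewrite natrM; apply: (@le_trans _ _ (d%:R * expR (beta * r%:R))%R).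
    by rewrite ler_pM2l.
  by rewrite ler_peMl ?ler1n // mulr_ge0 ?expR_ge0.
Qed.
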